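(* If $G$ and $H$ are nontrivial connected graphs such that $\iota(H)\geq 2$, then $\iota(G \circ H)=\gamma(G \circ H)=\gamma_t(G)$.
   Context: All graphs are finite and simple; nontrivial means at least two vertices. $G\circ H$ is the lexicographic product: vertex set $V(G)\times V(H)$, with $(g,h)$ adjacent to $(g_1,h_1)$ iff $gg_1\in E(G)$, or $g=g_1$ and $hh_1\in E(H)$. $\gamma$ is the domination number and $\gamma_t$ the total domination number. A set $A$ of vertices is isolating if no two vertices outside the closed neighborhood $N[A]$ are adjacent; $\iota$ is the minimum size of an isolating set. *)

(* Defs.v *)
From mathcomp Require Import all_boot.

Set Implicit Arguments.
Unset Strict Implicit.
Unset Printing Implicit Defensive.

Record sgraph := SGraph {
  vertex :> finType;
  adj : rel vertex;
  adj_sym : symmetric adj;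
  adj_irrefl : irreflexive adj
}.

Arguments adj {s}.

Definition nontrivial (G : sgraph) := 1 < #|G|.

(* The empty graph satisfies this; it is excluded by [nontrivial]. *)
Definition connected (G : sgraph) := forall x y : G, connect adj x y.

Section Domination.
Variable G : sgraph.
Implicit Types A : {set G}.

Definition open_nbhd (v : G) : {set G} := [set u | adj v u].
Definition closed_nbhd (v : G) : {set G} := v |: open_nbhd v.

Definition closed_nbhds A : {set G} := \bigcup_(v in A) closed_nbhd v.
Definition open_nbhds A : {set G} := \bigcup_(v in A) open_nbhd v.

Definition dominating A := closed_nbhds A == [set: G].
Definition total_dominating A := open_nbhds A == [set: G].
Definition isolating A :=
  [forall u, forall v,
    (u \notin closed_nbhds A) && (v \notin closed_nbhds A) ==> ~~ adj u v].

(* [setT] is always dominating and always isolating. It is total dominating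
   iff G has no isolated vertex, which is also exactly when some total
   dominating set exists; otherwise [total_dom_number] has the junk value #|G|. *)
Definition dom_number : nat :=
  #|[arg min_(A < [set: G] | dominating A) #|A|]|.
Definition total_dom_number : nat :=
  #|[arg min_(A < [set: G] | total_dominating A) #|A|]|.
Definition isolation_number : nat :=
  #|[arg min_(A < [set: G] | isolating A) #|A|]|.

End Domination.

Section LexicographicProduct.
Variables G H : sgraph.

Definition lex_adj : rel (G * H)%type := fun x y =>
  adj x.1 y.1 || (x.1 == y.1) && adj x.2 y.2.

Fact lex_adj_sym : symmetric lex_adj.
Proof.
by move=> x y; rewrite /lex_adj adj_sym eq_sym (adj_sym x.2).
Qed.

Fact lex_adj_irrefl : irreflexive lex_adj.
Proof. by move=> x; rewrite /lex_adj !adj_irrefl andbF. Qed.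

Definition lex_product : sgraph := SGraph lex_adj_sym lex_adj_irrefl.

End LexicographicProduct.

(* Main.v *)
Require Import Defs.
From mathcomp Require Import all_boot.

Set Implicit Arguments.
Unset Strict Implicit.
Unset Printing Implicit Defensive.

(** A minimum isolating set [S] of [lex_product G H] meets the layer over [g]
    in a set isolating [H], hence in at least two vertices, unless [g] has a
    neighbour in the projection [P] of [S]. So adding to [P] one neighbour of
    each vertex whose layer contains two vertices of [S] yields a total
    dominating set of [G], and each added vertex is paid for by the second
    vertex of [S] in its layer. Conversely, a copy of a total dominating set of
    [G] inside one [H]-coordinate dominates the product. *)

Lemma closed_nbhdsP (G : sgraph) (A : {set G}) (u : G) :
  reflect (exists2 v, v \in A & (u == v) || adj v u) (u \in closed_nbhds A).
Proof.
apply: (iffP bigcupP) => -[v vA uv]; exists v => //.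
  by move: uv; rewrite !inE.
by rewrite !inE.
Qed.

Lemma open_nbhdsP (G : sgraph) (A : {set G}) (u : G) :
  reflect (exists2 v, v \in A & adj v u) (u \in open_nbhds A).
Proof.
by apply: (iffP bigcupP) => -[v vA uv]; exists v => //; move: uv; rewrite !inE.
Qed.

Lemma isolatingP (G : sgraph) (A : {set G}) :
  reflect (forall u v, u \notin closed_nbhds A -> v \notin closed_nbhds A ->
             ~~ adj u v)
          (isolating A).
Proof.
apply: (iffP forallP) => [isoA u v uA vA|isoA u].
  by have /forallP/(_ v) := isoA u; rewrite uA vA.
by apply/forallP => v; apply/implyP => /andP[]; apply: isoA.
Qed.

Lemma dominating_isolating (G : sgraph) (A : {set G}) :
  dominating A -> isolating A.
Proof. by move=> /eqP domA; apply/isolatingP => u v; rewrite domA inE. Qed.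

Lemma dominating_setT (G : sgraph) : dominating [set: G].
Proof.
apply/eqP/setP => u; rewrite in_setT; apply/closed_nbhdsP.
by exists u; rewrite ?in_setT ?eqxx.
Qed.

Lemma isolating_setT (G : sgraph) : isolating [set: G].
Proof. exact/dominating_isolating/dominating_setT. Qed.

Lemma isolation_number_min (G : sgraph) (A : {set G}) :
  isolating A -> isolation_number G <= #|A|.
Proof.
rewrite /isolation_number.
by case: arg_minnP => [|B _]; [exact: isolating_setT | apply].
Qed.

Lemma isolation_number_attained (G : sgraph) :
  exists2 A : {set G}, isolating A & #|A| = isolation_number G.
Proof.
rewrite /isolation_number.
by case: arg_minnP => [|B]; [exact: isolating_setT | exists B].
Qed.

Lemma dom_number_min (G : sgraph) (A : {set G}) :
  dominating A -> dom_number G <= #|A|.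
Proof.
rewrite /dom_number.
by case: arg_minnP => [|B _]; [exact: dominating_setT G | apply].
Qed.

Lemma dom_number_attained (G : sgraph) :
  exists2 A : {set G}, dominating A & #|A| = dom_number G.
Proof.
rewrite /dom_number.
by case: arg_minnP => [|B]; [exact: dominating_setT G | exists B].
Qed.

Lemma isolation_number_le_dom_number (G : sgraph) :
  isolation_number G <= dom_number G.
Proof.
have [A /dominating_isolating isoA <-] := dom_number_attained G.
exact: isolation_number_min.
Qed.

(** A path from [u] to any other vertex has a first step, which is a neighbour of [u]. *)
Lemma exists_neighbor (G : sgraph) :
  nontrivial G -> connected G -> forall u : G, exists v, adj u v.
Proof.
move=> ntG connG u.
have [w wu] : exists w, w != u.
  apply/existsP; apply: contraLR ntG => /existsPn eq_u.
  rewrite -leqNgt; apply/card_le1P => x _ y; rewrite !inE.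
  have /negPn/eqP -> := eq_u x; have /negPn/eqP -> := eq_u y.
  by rewrite eqxx.
(* The empty path would give [w = u]; otherwise the head [v] of the path is the neighbour. *)
case/connectP: (connG u w) => -[|v p] /=; last by case/andP; exists v.
by move=> _ eq_wu; rewrite eq_wu eqxx in wu.
Qed.

Section NoIsolatedVertex.
Variable G : sgraph.
Hypothesis has_neighbor : forall u : G, exists v, adj u v.

(** Makes the default of the [arg min] admissible, so that [total_dom_number] is a genuine
    minimum. *)
Lemma total_dominating_setT : total_dominating [set: G].
Proof.
apply/eqP/setP => u; rewrite in_setT; apply/open_nbhdsP.
by have [v uv] := has_neighbor u; exists v; rewrite ?in_setT // adj_sym.
Qed.

Lemma total_dom_number_min (A : {set G}) :
  total_dominating A -> total_dom_number G <= #|A|.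
Proof.
rewrite /total_dom_number.
by case: arg_minnP => [|B _]; [exact: total_dominating_setT | apply].
Qed.

Lemma total_dom_number_attained :
  exists2 A : {set G}, total_dominating A & #|A| = total_dom_number G.
Proof.
rewrite /total_dom_number.
by case: arg_minnP => [|B]; [exact: total_dominating_setT | exists B].
Qed.

End NoIsolatedVertex.

(** A vertex [a] of [A] adjacent to [g] makes [(a, h)] adjacent to the whole layer over [g],
    whatever the second coordinates are. *)
Lemma dominating_setX1 (G H : sgraph) (A : {set G}) (h : H) :
  total_dominating A -> @dominating (lex_product G H) (setX A [set h]).
Proof.
move=> /eqP tdA; apply/eqP/setP => -[g k]; rewrite in_setT.
apply/closed_nbhdsP; have /open_nbhdsP[a aA ag] : g \in open_nbhds A.
  by rewrite tdA inE.
by exists (a, h); rewrite ?inE ?aA ?eqxx //= /lex_adj /= ag orbT.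
Qed.

Section Layers.
Variables G H : sgraph.
Implicit Type S : {set lex_product G H}.

Definition layer S (g : G) : {set H} := [set h | (g, h) \in S].

Definition projection S : {set G} := [set g | layer S g != set0].

Lemma card_layers S : #|S| = \sum_(g : G) #|layer S g|.
Proof.
transitivity (\sum_(g : G) \sum_(h : H | (g, h) \in S) 1).
  by rewrite pair_big_dep /= -sum1_card; apply: eq_bigl => -[].
by apply: eq_bigr => g _; rewrite sum1_card cardsE.
Qed.

(** When [g] has no neighbour in the projection, [S] can reach the layer over [g] only from inside
    that layer. An edge of [H] missed by [layer S g] would thus lift to an edge of the product
    missed by [S]. *)
Lemma isolating_layer S (g : G) :
  isolating S -> g \notin open_nbhds (projection S) -> isolating (layer S g).
Proof.
move=> /isolatingP isoS gP; apply/isolatingP.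
have lift h : h \notin closed_nbhds (layer S g) ->
    ((g, h) : lex_product G H) \notin closed_nbhds S.
  apply: contra => /closed_nbhdsP[[a b] abS] /=; rewrite /lex_adj xpair_eqE /=.
  (* A vertex [(a, b)] of [S] reaching [(g, h)] has [a] adjacent to [g], which the hypothesis on [g]
     excludes, or [a = g], and then [b] reaches [h] within [H]. *)
  have [ag|_] := boolP (adj a g).
    case/negP: gP; apply/open_nbhdsP; exists a => //.
    by rewrite inE; apply/set0Pn; exists b; rewrite inE.
  rewrite [g == a]eq_sym /=; have [ag|//] /= := eqVneq a g => hb.
  by apply/closed_nbhdsP; exists b; rewrite // inE -ag.
move=> u v /lift uS /lift vS; move: (isoS _ _ uS vS).
by rewrite /= /lex_adj /= adj_irrefl eqxx.
Qed.

Lemma total_dom_number_le_isolation_number :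
  (forall g : G, exists g', adj g g') -> 2 <= isolation_number H ->
  total_dom_number G <= isolation_number (lex_product G H).
Proof.
move=> nbr isoH.
have [S isoS <-] := isolation_number_attained (lex_product G H).
pose f g := xchoose (nbr g); have fP g : adj g (f g) by apply: xchooseP.
pose Q := [set g | 1 < #|layer S g|].
have tdPQ : total_dominating (projection S :|: f @: Q).
  apply/eqP/setP => g; rewrite in_setT; apply/open_nbhdsP.
  have [/open_nbhdsP[a aP ag]|gP] := boolP (g \in open_nbhds (projection S)).
    by exists a; rewrite // inE aP.
  (* Here the layer over [g] isolates [H], so it has at least two vertices and [g] lies in [Q]; the
     chosen neighbour [f g] then covers [g]. *)
  exists (f g); last by rewrite adj_sym.
  rewrite inE imset_f ?orbT // inE.
  exact: leq_trans isoH (isolation_number_min (isolating_layer isoS gP)).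
apply: leq_trans (total_dom_number_min nbr tdPQ) _.
apply: leq_trans (leq_card_setU _ _) _.
apply: leq_trans (leq_add (leqnn _) (leq_imset_card f Q)) _.
have -> : #|projection S| = \sum_g (layer S g != set0).
  by rewrite -sum1_card big_mkcond; apply: eq_bigr => g _; rewrite inE.
have -> : #|Q| = \sum_g (1 < #|layer S g|).
  by rewrite -sum1_card big_mkcond; apply: eq_bigr => g _; rewrite inE.
(* Both cardinals are now sums of indicators over [G]. It remains to compare layer by layer: a layer
   of size [n] contributes 0, 1 or 2 according to whether [n] is 0, 1 or larger, hence at most
   [n]. *)
rewrite card_layers -big_split /=.
apply: leq_sum => g _; rewrite -cards_eq0.
by case: #|layer S g| => [|[|n]].
Qed.

End Layers.

Theorem theorem4p2 (G H : sgraph) :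
  nontrivial G -> connected G ->
  nontrivial H -> connected H ->
  2 <= isolation_number H ->
  isolation_number (lex_product G H) = dom_number (lex_product G H) /\
  dom_number (lex_product G H) = total_dom_number G.
Proof.
move=> ntG connG ntH _ isoH; have nbr := exists_neighbor ntG connG.
have le_iso_dom := isolation_number_le_dom_number (lex_product G H).
have le_td_iso := total_dom_number_le_isolation_number nbr isoH.
have le_dom_td : dom_number (lex_product G H) <= total_dom_number G.
  have /card_gt0P[h _] : 0 < #|H| by exact: ltnW ntH.
  have [A tdA <-] := total_dom_number_attained nbr.
  rewrite -[leqRHS]muln1 -(cards1 h) -cardsX.
  exact: dom_number_min (dominating_setX1 h tdA).
(* The three inequalities form a cycle, which forces equality throughout. *)
split; apply/eqP; rewrite eqn_leq.
  by rewrite le_iso_dom (leq_trans le_dom_td).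
by rewrite le_dom_td (leq_trans le_td_iso).
Qed.
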